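(* Let $(K,|\cdot|_K)$ be a non-archimedean local field with residue class field $k_K$, let $n \geq 2$ be an integer, and suppose $\mathrm{char}\,k_K > n$. Then for all integers $1 \leq m \leq n$ and all $\alpha \in \mathbb{N}$, the inequality $$\|Ef\|_{L^{2m}(B(\mathbf{x}, q_K^{\alpha n}))} \leq (m!)^{1/2m}\, \Big\|\Big( \sum_{I \in \mathcal{I}(q_K^{-\alpha})} |E(f\chi_I)|^2\Big)^{1/2}\Big\|_{L^{2m}(B(\mathbf{x}, q_K^{\alpha n}))}$$ holds for all $f \in L^1(\mathfrak{o}_K)$ and all $\mathbf{x} \in K^n$, where $E$ is the extension operator $$Ef(\mathbf{x}) := \int_{\mathfrak{o}_K} e(x_1 t + x_2 t^2 + \cdots + x_n t^n) f(t)\, d\mu(t), \qquad \mathbf{x} = (x_1,\dots,x_n) \in K^n.$$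
   Context: A non-archimedean local field $(K,|\cdot|_K)$ is a field $K$ with an absolute value $|\cdot|_K : K \to [0,\infty)$ which is multiplicative, vanishes only at $0$, and satisfies $|x+y|_K \leq \max\{|x|_K,|y|_K\}$, such that $|\cdot|_K$ is non-trivial and discrete (the value group $\{|x|_K : x \in K\setminus\{0\}\}$ is a discrete subgroup of $(0,\infty)$), $K$ is complete, and the residue class field is finite. The ring of integers is $\mathfrak{o}_K := \{x \in K : |x|_K \leq 1\}$, its maximal ideal is $\mathfrak{m}_K := \{x \in K: |x|_K < 1\}$, and the residue class field is $k_K := \mathfrak{o}_K/\mathfrak{m}_K$. A uniformiser $\pi_K$ is a generator of $\mathfrak{m}_K$, and $q_K := |\pi_K|_K^{-1} > 1$. $\mu$ is the Haar measure on $(K,+)$ normalised so that $\mu(\mathfrak{o}_K) = 1$. The map $e \colon K \to \mathbb{C}$ is a fixed (continuous, unitary) additive character of $K$ which is identically $1$ on $\mathfrak{o}_K$ and is non-principal (not identically $1$) on $\pi_K^{-1}\mathfrak{o}_K$. For $\alpha \in \mathbb{N}$, $\mathcal{I}(q_K^{-\alpha})$ is the (finite) collection of distinct balls of the form $\{t \in \mathfrak{o}_K : |t - x|_K \leq q_K^{-\alpha}\}$ with $x \in \mathfrak{o}_K$; these partition $\mathfrak{o}_K$. $\chi_I$ is the characteristic function of $I$. $K^n$ carries the norm $|\mathbf{x}|_K := \max\{|x_1|_K,\dots,|x_n|_K\}$, and $B(\mathbf{x},r) := \{\mathbf{y} \in K^n : |\mathbf{y}-\mathbf{x}|_K \leq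 r\}$. $L^p$ norms on subsets of $K^n$ are taken with respect to the $n$-fold product of $\mu$. *)

(* Defs.v *)
From HB Require Import structures.
From mathcomp Require Import all_boot all_order all_algebra.
From mathcomp Require Import generic_quotient ring_quotient.
From mathcomp Require Import all_classical all_reals all_analysis.
From mathcomp.real_closed Require Import complex.

Set Implicit Arguments.
Unset Strict Implicit.
Unset Printing Implicit Defensive.

Import Order.TTheory GRing.Theory Num.Theory.
Import numFieldNormedType.Exports.

Local Open Scope classical_set_scope.
Local Open Scope ring_scope.

HB.mixin Record Field_isNonArchField (R : realType) K & GRing.Field K := {
  vabs : K -> R;
  vabs_ge0 : forall x, 0 <= vabs x;
  vabs_eq0 : forall x, vabs x = 0 <-> x = 0;
  vabsM : forall x y, vabs (x * y) = vabs x * vabs y;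
  vabsD : forall x y, vabs (x + y) <= Num.max (vabs x) (vabs y)
}.

#[short(type="nonArchFieldType")]
HB.structure Definition NonArchField (R : realType) :=
  { K of GRing.Field K & Field_isNonArchField R K }.

Section ValuationRing.
Context {R : realType} {K : nonArchFieldType R}.

Lemma vabs0 : vabs (0 : K) = 0.
Proof. exact/vabs_eq0. Qed.

Lemma vabs1 : vabs (1 : K) = 1.
Proof.
have nz : vabs (1 : K) != 0 by apply/eqP => /vabs_eq0/eqP; rewrite oner_eq0.
by apply: (mulfI nz); rewrite -vabsM !mulr1.
Qed.

Lemma vabsN (x : K) : vabs (- x) = vabs x.
Proof.
apply/eqP; rewrite -(@eqrXn2 _ 2) ?vabs_ge0//.
by rewrite !expr2 -!vabsM mulrNN.
Qed.

Definition vdist (x y : K) : R := vabs (x - y).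

Lemma vdistxx x : vdist x x = 0.
Proof. by rewrite /vdist subrr vabs0. Qed.

Lemma vdist_eq0 x y : vdist x y = 0 -> x = y.
Proof. by move=> /vabs_eq0/subr0_eq. Qed.

Lemma vdistC x y : vdist x y = vdist y x.
Proof. by rewrite /vdist -vabsN opprB. Qed.

Lemma vdist_triangle y x z : vdist x z <= vdist x y + vdist y z.
Proof.
rewrite /vdist -(subrKA y) (le_trans (vabsD _ _))// ge_max.
by rewrite lerDl vabs_ge0 lerDr vabs_ge0.
Qed.

(* K carries the topology and uniform structure of the distance |x - y|. *)
HB.instance Definition _ := isPointed.Build K 0.
HB.instance Definition _ :=
  isMetric.Build R K vdistxx vdist_eq0 vdistC vdist_triangle.

Definition val_ring_pred : {pred K} := [pred x | vabs x <= 1].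

Lemma val_ring_closed : subring_closed val_ring_pred.
Proof.
split=> [|x y|x y]; rewrite !inE ?vabs1// => hx hy.
  by rewrite (le_trans (vabsD _ _))// vabsN ge_max hx.
by rewrite vabsM mulr_ile1 ?vabs_ge0.
Qed.

HB.instance Definition _ :=
  GRing.isSubringClosed.Build K val_ring_pred val_ring_closed.

Record val_ring : predArgType :=
  ValRing { val_ring_val :> K; _ : val_ring_val \in val_ring_pred }.

HB.instance Definition _ := [isSub for val_ring_val].
HB.instance Definition _ := [Choice of val_ring by <:].
HB.instance Definition _ := [SubChoice_isSubComNzRing of val_ring by <:].

Definition max_ideal_pred : {pred val_ring} :=
  [pred x | vabs (val_ring_val x) < 1].

Lemma max_ideal_closed : idealr_closed max_ideal_pred.
Proof.
split=> [||a u v]; rewrite !inE/= ?vabs0 ?ltr01 ?vabs1 ?ltxx// => hu hv.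
rewrite (le_lt_trans (vabsD _ _))// gt_max hv andbT vabsM.
have ha : vabs (a : K) <= 1 by case: (a).
by rewrite (le_lt_trans _ hu)// ler_piMl ?vabs_ge0.
Qed.

HB.instance Definition _ :=
  isIdealr.Build val_ring max_ideal_pred max_ideal_closed.

Definition residue_field := {ideal_quot max_ideal_pred}.

HB.instance Definition _ := GRing.ComNzRing.on residue_field.

End ValuationRing.
Arguments val_ring {R} K.
Arguments max_ideal_pred {R} K.
Arguments residue_field {R} K.

Definition ring_of_integers {R : realType} (K : nonArchFieldType R) : set K :=
  [set x | vabs x <= 1].

Definition maximal_ideal {R : realType} (K : nonArchFieldType R) : set K :=
  [set x | vabs x < 1].

Definition value_group {R : realType} (K : nonArchFieldType R) : set R :=
  [set vabs x | x in [set x : K | x != 0]].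

Arguments ring_of_integers {R} K.
Arguments maximal_ideal {R} K.
Arguments value_group {R} K.

Record local_field (R : realType) (K : nonArchFieldType R) : Prop := {
  vabs_nontrivial : exists x : K, x != 0 /\ vabs x != 1;
  value_group_discrete :
    value_group K `<=` isolated (value_group K);
  local_field_complete :
    forall F : set_system K, ProperFilter F -> cauchy F -> cvg F;
  residue_field_finite : finite_set [set: residue_field K]
}.

(* Borel sigma-algebra *)
HB.instance Definition _ (R : realType) (K : nonArchFieldType R) :=
  Measurable.copy K (g_sigma_algebraType (@open K)).


Section ProductMeasure.
Context d (T : measurableType d) (R : realType).
Local Open Scope ereal_scope.

Definition cons_pair n (p : T * n.-tuple T) : n.+1.-tuple T :=
  [tuple of p.1 :: p.2].

Lemma measurable_cons_pair n : measurable_fun setT (@cons_pair n).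
Proof. exact: (measurable_cons measurable_fst measurable_snd). Qed.

Section Step.
Variables (n : nat) (m1 : {sigma_finite_measure set T -> \bar R})
  (m2 : {sigma_finite_measure set (n.-tuple T) -> \bar R}).

Definition cons_measure : set (n.+1.-tuple T) -> \bar R :=
  pushforward (m1 \x m2) (@cons_pair n).

Let cons_measure0 : cons_measure set0 = 0.
Proof. by rewrite /cons_measure /pushforward preimage_set0 measure0. Qed.

Let cons_measure_ge0 A : 0 <= cons_measure A.
Proof. by rewrite /cons_measure /pushforward; exact: (measure_ge0 (m1 \x m2)%E). Qed.

Let cons_measure_sigma_additive : semi_sigma_additive cons_measure.
Proof.
have mf := @measurable_cons_pair n.
move=> F mF tF mUF; rewrite /cons_measure /pushforward preimage_bigcup.
apply: measure_semi_sigma_additive.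
- by move=> k; rewrite -[X in measurable X]setTI; exact: mf.
- apply/trivIsetP => /= i j _ _ ij; rewrite -preimage_setI.
  by move/trivIsetP : tF => /(_ _ _ _ _ ij) ->//; rewrite preimage_set0.
- by rewrite -preimage_bigcup -[X in measurable X]setTI; exact: mf.
Qed.

HB.instance Definition _ := isMeasure.Build _ _ _ cons_measure
  cons_measure0 cons_measure_ge0 cons_measure_sigma_additive.

Let cons_measure_sigma_finite : sigma_finite setT cons_measure.
Proof.
have /sigma_finiteP[F1 [TF1 ndF1 F1oo]] := sigma_finiteT m1.
have /sigma_finiteP[F2 [TF2 ndF2 F2oo]] := sigma_finiteT m2.
pose F k := F1 k `*` F2 k.
have TF : [set: T * n.-tuple T] = \bigcup_k F k.
  rewrite -setXTT TF1 TF2; apply/seteqP; split => -[x y].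
    move=> [/= [i _ Fx] [j _ Gy]]; exists (maxn i j) => //; split.
    - by move: x Fx; exact/subsetPset/ndF1/leq_maxl.
    - by move: y Gy; exact/subsetPset/ndF2/leq_maxr.
  by move=> [i _ [/= ? ?]]; split; exists i.
have Foo k : measurable (F k) /\ (m1 \x m2) (F k) < +oo.
  have [? ?] := F1oo k; have [? ?] := F2oo k.
  split; first exact: measurableX.
  by rewrite product_measure1E// lte_mul_pinfty// ge0_fin_numE.
pose g (t : n.+1.-tuple T) : T * n.-tuple T := (thead t, [tuple of behead t]).
have mg : measurable_fun setT g.
  apply/measurable_fun_pairP; split.
    by apply: measurable_tnth.
  exact: measurable_behead.
have gK : cancel (@cons_pair n) g.
  by case=> x t; rewrite /g /cons_pair theadE; congr pair; apply: val_inj.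
exists (fun k => g @^-1` F k).
  by rewrite -preimage_bigcup -TF preimage_setT.
move=> k; have [mFk Fkoo] := Foo k; split.
  by rewrite -[X in measurable X]setTI; exact: mg.
rewrite /cons_measure /pushforward -comp_preimage.
by rewrite (_ : g \o _ = id)//; apply/funext => x; exact: gK.
Qed.

HB.instance Definition _ := Measure_isSigmaFinite.Build _ _ _ cons_measure
  cons_measure_sigma_finite.

End Step.

(* The library only provides binary products of measures; the n-fold product
   is built from them along T^(n+1) = T * T^n, and [prod_measureE] is its
   characteristic property. Sigma-finiteness is what makes [m1 \x m2] a
   measure. *)
Fixpoint prod_measure (mu : {sigma_finite_measure set T -> \bar R}) n :
    {sigma_finite_measure set (n.-tuple T) -> \bar R} :=
  if n is n'.+1 then cons_measure mu (prod_measure mu n')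
  else dirac [tuple].

Lemma prod_measureE (mu : {sigma_finite_measure set T -> \bar R}) n
    (A : 'I_n -> set T) : (forall i, measurable (A i)) ->
  prod_measure mu n [set x | forall i, A i (tnth x i)] =
  \prod_(i < n) mu (A i).
Proof.
elim: n A => [|n IH] A mA /=.
  by rewrite big_ord0 diracE mem_set//= => -[].
rewrite big_ord_recl -IH// /cons_measure /pushforward -product_measure1E//.
  congr (_ _); apply/seteqP; split => [[x t]/= h|[x t]/= [h0 h] i].
    by split; [have := h ord0|move=> i; have := h (lift ord0 i); rewrite tnthS].
  by case: (unliftP ord0 i) => [j ->|->]; rewrite ?tnthS.
rewrite (_ : mkset _ = \bigcap_(i : 'I_n) ((@tnth n T)^~ i @^-1` A (lift ord0 i))).
  apply: fin_bigcap_measurable => // i _.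
  by rewrite -[X in measurable X]setTI; exact: measurable_tnth.
by apply/seteqP; split => [t h i _|t h i]; exact: h.
Qed.

End ProductMeasure.

Section ComplexIntegral.
Context d (T : measurableType d) (R : realType).
Variable mu : {measure set T -> \bar R}.

Definition cabs (z : R[i]) : R := ComplexField.Normc.normc z.

Definition cintegral (D : set T) (f : T -> R[i]) : R[i] :=
  Complex (\int[mu]_(x in D) complex.Re (f x))%R
          (\int[mu]_(x in D) complex.Im (f x))%R.

Definition L1 (D : set T) (f : T -> R[i]) : Prop :=
  [/\ measurable_fun D (fun x => complex.Re (f x)),
      measurable_fun D (fun x => complex.Im (f x)) &
      (\int[mu]_(x in D) (cabs (f x))%:E < +oo)%E].

End ComplexIntegral.

Section Extension.
Context (R : realType) (K : nonArchFieldType R).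
Implicit Types (mu : {sigma_finite_measure set K -> \bar R}) (n : nat).

Definition is_uniformiser (pi : K) : Prop :=
  maximal_ideal K = [set pi * y | y in ring_of_integers K].

(* Haar measure as a translation-invariant Radon measure on the Borel sets. The
   bundled sigma-finiteness of [mu] is automatic, K being sigma-compact when it
   is a local field. *)
Record normalised_haar mu : Prop := {
  haar_translation : forall (x : K) (A : set K), measurable A ->
    mu [set x + y | y in A] = mu A;
  haar_compact : forall C : set K, compact C -> (mu C < +oo)%E;
  haar_outer_regular : forall A : set K, measurable A ->
    mu A = ereal_inf [set mu U | U in [set U | open U /\ A `<=` U]];
  haar_inner_regular : forall U : set K, open U ->
    mu U = ereal_sup [set mu C | C in [set C | compact C /\ C `<=` U]];
  haar_normalised : mu (ring_of_integers K) = 1%E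
}.

(* [(R[i])^o] is R[i] with the topology of its norm. *)
Record standard_character (pi : K) (e : K -> R[i]) : Prop := {
  char_continuous : continuous (e : K -> (R[i])^o);
  char_unitary : forall x, cabs (e x) = 1;
  char_add : forall x y, e (x + y) = e x * e y;
  char_trivial : forall x, ring_of_integers K x -> e x = 1;
  char_nonprincipal : exists2 x, ring_of_integers K x & e (pi^-1 * x) != 1
}.

(* [extension mu e f x] is (Ef)(x); the coordinate x_(i+1) is
   [tnth x i], hence the exponent [i.+1]. *)
Definition extension mu (e : K -> R[i]) n (f : K -> R[i]) (x : n.-tuple K) :
    R[i] :=
  cintegral mu (ring_of_integers K)
    (fun t => e (\sum_(i < n) tnth x i * t ^+ i.+1) * f t).

(* The set of the distinct balls; a set of sets, so that a ball with several
   centres is counted once. *)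
Definition integer_balls (r : R) : set (set K) :=
  [set [set t | ring_of_integers K t /\ vabs (t - x) <= r]
     | x in ring_of_integers K].

Definition restrict_to (I : set K) (f : K -> R[i]) : K -> R[i] :=
  fun t => f t * (\1_I t)%:C%C.

Definition square_function mu (e : K -> R[i]) n (r : R) (f : K -> R[i])
    (x : n.-tuple K) : R :=
  Num.sqrt (\sum_(I \in integer_balls r)
    cabs (extension mu e (restrict_to I f) x) ^+ 2).

Definition Kn_norm n (x : n.-tuple K) : R :=
  \big[Num.max/0]_(i < n) vabs (tnth x i).

Definition Kn_ball n (x : n.-tuple K) (r : R) : set (n.-tuple K) :=
  [set y | Kn_norm [tuple tnth y i - tnth x i | i < n] <= r].

Definition Lp_norm_on mu n (p : R) (B : set (n.-tuple K))
    (g : n.-tuple K -> R) : \bar R :=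
  'N[prod_measure mu n]_(p%:E)[(EFin \o g) \_ B].

End Extension.

(* Main.v *)
Require Import Defs.
From mathcomp Require Import all_boot all_order all_algebra.
From mathcomp Require Import fingroup perm generic_quotient ring_quotient ring.
From mathcomp Require Import all_classical all_reals all_analysis measurable_realfun.
From mathcomp.real_closed Require Import complex.

Set Implicit Arguments.
Unset Strict Implicit.
Unset Printing Implicit Defensive.

Import Order.TTheory GRing.Theory Num.Theory.
Import numFieldNormedType.Exports.

Local Open Scope classical_set_scope.
Local Open Scope ring_scope.

(** The points of the ball have bounded size, so the phase only depends on the
    integral [t] modulo a high power of the uniformiser, and on the ball both
    sides are finite trigonometric sums ([extension_net_sum]). These are
    constant on translates of the integral points of [K^n]; the ball is a
    finite union of such translates, each of measure [1], and the two norms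
    become finite sums over a transversal ([Lp_norm_on_box]). No limit or
    Fubini argument is left.

    Expand [|Ef|^(2m)] as a sum over pairs of [m]-tuples of balls [I]. A pair
    contributes the sum, over the transversal, of products of [m] characters
    at frequencies [t_1, ..., t_m] times conjugates at [s_1, ..., s_m], where
    the [t_i] and [s_j] lie in the given balls ([char_phase_prod]). By
    orthogonality ([char_box_sum0]) it vanishes unless the power sums of the
    [t_i] and of the [s_i] of orders [1, ..., n] agree to precision [q ^-
    (alpha * n)]. Then, and this is the heart of the matter, the tuples of
    balls are rearrangements of each other ([count_ball_eq]). Only diagonal
    terms remain, each repeated at most [m!] times, and without their
    multiplicities they add up to the [m]-th power of the square function
    ([sum_norm_pow_le_square_function]).

    For the heart of the matter, the residue characteristic exceeds [n], so
    Newton's identities can be solved for the elementary symmetric functions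
    without loss ([coef_rev_root_poly_close]): after any translation, the two
    polynomials with these roots are close. The number of roots outside the
    ball of radius [r] around [0] is read off the Newton polygon, as the
    position of the largest coefficient weighted by powers of [r]
    ([newton_vertex]). That weighted maximum is at least [1], and for [r = q
    ^- alpha] and [m <= n] the error [r ^+ n] is too small to move it
    ([count_large_le]). Comparing these counts ball by ball avoids any pairing
    of the individual [t_i] with the [s_j]. *)

(** * Newton's identities *)

Section Newton.
Context {A : comNzRingType}.
Implicit Types (u : seq A) (t : A).

(** The reversal of the monic polynomial with roots [u]: its [k]-th coefficient
    is, up to sign, the [k]-th elementary symmetric function of [u]. In this
    form the roots are the reciprocals, so that the logarithmic derivative
    involves only nonnegative powers of ['X]. *)
Definition rev_root_poly u : {poly A} := \prod_(t <- u) (1 - t *: 'X).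

Definition power_sum u k : A := \sum_(t <- u) t ^+ k.

Lemma rev_root_poly_cons t u :
  rev_root_poly (t :: u) = (1 - t *: 'X) * rev_root_poly u.
Proof. exact: big_cons. Qed.

Lemma coef_rev_root_poly_cons t u i :
  (rev_root_poly (t :: u))`_i =
  (rev_root_poly u)`_i - (if i is j.+1 then t * (rev_root_poly u)`_j else 0).
Proof.
rewrite rev_root_poly_cons mulrBl mul1r coefB -scalerAl coefZ coefXM.
by case: i => [|i] /=; rewrite ?mulr0.
Qed.

Lemma coef0_rev_root_poly u : (rev_root_poly u)`_0 = 1.
Proof.
elim: u => [|t u IH]; first by rewrite /rev_root_poly big_nil coef1.
by rewrite coef_rev_root_poly_cons IH subr0.
Qed.

(** The logarithmic derivative of [rev_root_poly u] is minus the generating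
    series of the power sums; truncating that series at order [N] leaves an
    error divisible by ['X^N]. *)
Lemma rev_root_poly_log_deriv u N : exists Q,
  (rev_root_poly u)^`() +
  rev_root_poly u * \poly_(k < N) power_sum u k.+1 = 'X^N * Q.
Proof.
elim: u => [|t u [Q IH]].
  exists 0; rewrite mulr0 /rev_root_poly big_nil derivC add0r mul1r.
  by apply/polyP => i; rewrite coef_poly /power_sum big_nil if_same coef0.
have geo : (1 - t *: 'X) * (\poly_(k < N) t ^+ k.+1) =
    t%:P - t ^+ N.+1 *: 'X^N.
  rewrite poly_def mulr_sumr; elim: N {Q IH} => [|N IH].
    by rewrite big_ord0 expr1 expr0 alg_polyC subrr.
  rewrite big_ord_recr/= {}IH mulrBl mul1r -scalerAl -scalerAr scalerA -!exprS.
  by rewrite addrA subrK.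
exists ((1 - t *: 'X) * Q - t ^+ N.+1 *: rev_root_poly u).
rewrite rev_root_poly_cons.
have -> : \poly_(k < N) power_sum (t :: u) k.+1 =
    \poly_(k < N) t ^+ k.+1 + \poly_(k < N) power_sum u k.+1.
  apply/polyP => i; rewrite coefD !coef_poly /power_sum big_cons.
  by case: ifP; rewrite ?addr0.
rewrite derivM derivB derivC sub0r derivZ derivX alg_polyC.
transitivity ((1 - t *: 'X) * ((rev_root_poly u)^`() +
    rev_root_poly u * \poly_(k < N) power_sum u k.+1) +
  rev_root_poly u * ((1 - t *: 'X) * (\poly_(k < N) t ^+ k.+1) - t%:P)).
  ring.
rewrite IH geo -!mul_polyC; ring.
Qed.

Lemma newton_identity u k :
  (rev_root_poly u)`_k.+1 *+ k.+1 =
  - \sum_(j < k.+1) (rev_root_poly u)`_j * power_sum u (k - j).+1.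
Proof.
have [Q /(congr1 (fun p : {poly A} => p`_k))] := rev_root_poly_log_deriv u k.+1.
rewrite coefD coef_deriv coefM coefXnM ltnSn => /eqP; rewrite addr_eq0 => /eqP ->.
congr (- _); apply: eq_bigr => j _.
by rewrite coef_poly ltnS leq_subr.
Qed.

End Newton.

(** * Ultrametric estimates for coefficients *)

Section Ultrametric.
Context {R : realType} {K : nonArchFieldType R}.
Implicit Types (u v : seq K) (t : K) (r : R).

Lemma vabs_natr_le1 k : vabs (k%:R : K) <= 1.
Proof.
elim: k => [|k IH]; first by rewrite vabs0.
by rewrite -natr1 (le_trans (vabsD _ _))// ge_max IH vabs1 lexx.
Qed.

Lemma vabsX (x : K) k : vabs (x ^+ k) = vabs x ^+ k.
Proof. by elim: k => [|k IH]; rewrite ?vabs1// !exprS vabsM IH. Qed.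

Lemma vabsV (x : K) : vabs x^-1 = (vabs x)^-1.
Proof.
have [->|x0] := eqVneq x 0; first by rewrite invr0 vabs0 invr0.
have vx0 : vabs x != 0 by apply: contra_neq x0 => /vabs_eq0.
by apply: (mulfI vx0); rewrite -vabsM !divff// vabs1.
Qed.

Lemma vabsD_le (x y : K) r : vabs x <= r -> vabs y <= r -> vabs (x + y) <= r.
Proof. by move=> hx hy; rewrite (le_trans (vabsD _ _))// ge_max hx. Qed.

Lemma vabsB_le (x y : K) r : vabs x <= r -> vabs y <= r -> vabs (x - y) <= r.
Proof. by move=> hx hy; rewrite vabsD_le ?vabsN. Qed.

Lemma vabsB_sym (x y : K) : vabs (x - y) = vabs (y - x).
Proof. by rewrite -vabsN opprB. Qed.

Lemma vabsB_trans (z x y : K) r :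
  vabs (x - z) <= r -> vabs (z - y) <= r -> vabs (x - y) <= r.
Proof. by move=> h1 h2; rewrite -(subrKA z) vabsD_le. Qed.

Lemma vabsM_le1 (x y : K) r : vabs x <= 1 -> vabs y <= r -> vabs (x * y) <= r.
Proof.
move=> hx; rewrite vabsM => /(le_trans _); apply.
by rewrite ler_piMl ?vabs_ge0.
Qed.

Lemma vabs_expr_le1 (x : K) k : vabs x <= 1 -> vabs (x ^+ k) <= 1.
Proof. by move=> hx; rewrite vabsX exprn_ile1 ?vabs_ge0. Qed.

Lemma vabs_sum_le (I : Type) (s : seq I) (P : pred I) (F : I -> K) r :
  0 <= r -> (forall i, P i -> vabs (F i) <= r) ->
  vabs (\sum_(i <- s | P i) F i) <= r.
Proof.
move=> r0 h; elim/big_rec: _ => [|i x Pi hx]; first by rewrite vabs0.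
by rewrite vabsD_le ?h.
Qed.

Lemma vabs_sum_seq_le (I : eqType) (s : seq I) (F : I -> K) r :
  0 <= r -> {in s, forall i, vabs (F i) <= r} ->
  vabs (\sum_(i <- s) F i) <= r.
Proof. by move=> r0 h; rewrite big_seq vabs_sum_le. Qed.

(** The strong triangle inequality is an equality when the sizes differ. *)
Lemma vabsB_gt (x y : K) : vabs y < vabs x -> vabs (x - y) = vabs x.
Proof.
move=> yx; apply/le_anti/andP; split; first by rewrite vabsB_le ?lexx ?ltW.
have := vabsD (x - y) y; rewrite subrK le_max => /orP[//|].
by rewrite leNgt yx.
Qed.

Lemma vabs_subrXX (x y : K) k r : vabs x <= 1 -> vabs y <= 1 ->
  vabs (x - y) <= r -> vabs (x ^+ k - y ^+ k) <= r.
Proof.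
move=> hx hy hxy; rewrite subrXX mulrC vabsM_le1//.
apply: vabs_sum_le => // i _.
by rewrite vabsM_le1 ?vabs_expr_le1.
Qed.

Lemma vabs_coef_rev_root_poly_le1 u i :
  {in u, forall t, vabs t <= 1} -> vabs (rev_root_poly u)`_i <= 1.
Proof.
elim: u i => [|t u IH] i hu.
  by rewrite /rev_root_poly big_nil coef1; case: eqP; rewrite ?vabs1 ?vabs0.
have hu' : {in u, forall t, vabs t <= 1}.
  by move=> s su; apply: hu; rewrite inE su orbT.
rewrite coef_rev_root_poly_cons vabsB_le ?IH//; case: i => [|i]; rewrite ?vabs0//.
by rewrite vabsM_le1 ?IH ?hu ?mem_head.
Qed.

(** Newton's identities express the coefficients through the power sums with
    division by [1, ..., n], which are units here. *)
Lemma coef_rev_root_poly_close n u v r : 0 <= r ->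
  (forall k, (0 < k <= n)%N -> vabs (k%:R : K) = 1) ->
  {in u, forall t, vabs t <= 1} -> {in v, forall t, vabs t <= 1} ->
  (forall k, (0 < k <= n)%N -> vabs (power_sum u k - power_sum v k) <= r) ->
  forall k, (k <= n)%N -> vabs ((rev_root_poly u)`_k - (rev_root_poly v)`_k) <= r.
Proof.
move=> r0 nat1 hu hv huv; elim/ltn_ind => -[_ _|k IH kn].
  by rewrite !coef0_rev_root_poly subrr vabs0.
rewrite -[leLHS]mul1r -(nat1 k.+1)// -vabsM mulr_natl mulrnBl !newton_identity.
rewrite -opprD vabsN -sumrB vabs_sum_le// => j _.
have jk : (j <= k)%N by rewrite -ltnS.
have ik : (0 < (k - j).+1 <= n)%N by rewrite /= (leq_trans _ kn)// ltnS leq_subr.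
rewrite -(subrKA ((rev_root_poly v)`_j * power_sum u (k - j).+1)).
rewrite -mulrBl -mulrBr vabsD_le//; last first.
  by rewrite vabsM_le1 ?vabs_coef_rev_root_poly_le1 ?huv.
rewrite mulrC vabsM_le1//; last by apply: IH => //; rewrite ltnW// (leq_ltn_trans jk).
by apply: vabs_sum_seq_le => // t /hu; exact: vabs_expr_le1.
Qed.

(** A factor [1 - t 'X] with [vabs t <= r] does not move the first index at which
    the largest coefficient, weighted by [r ^- i], is attained; a factor with
    [r < vabs t] shifts it by one. Hence this index, the first vertex of the
    Newton polygon relative to [r], counts the large [t]. *)
Lemma newton_vertex u r : 0 < r -> exists G,
  let d := count (fun t => r < vabs t) u in
  [/\ 1 <= G,
      (0 < d)%N -> 1 < G,
      forall i, vabs (rev_root_poly u)`_i <= G * r ^+ i,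
      vabs (rev_root_poly u)`_d = G * r ^+ d &
      forall i, (i < d)%N -> vabs (rev_root_poly u)`_i < G * r ^+ i].
Proof.
move=> r0; elim: u => [|t u [G [G1 _ Gle Geq Glt]]].
  exists 1 => d; rewrite {}/d /rev_root_poly big_nil /=.
  split=> // [i|]; last by rewrite coef1 eqxx vabs1 expr0 mul1r.
  rewrite mul1r coef1; case: eqP => [->|_]; first by rewrite expr0 vabs1.
  by rewrite vabs0 exprn_ge0 ?ltW.
have G0 : 0 < G by exact: lt_le_trans G1.
have rX i : 0 < r ^+ i by exact: exprn_gt0.
rewrite /=; set d := count _ u in Geq Glt *.
have [rt|tr] := ltP r (vabs t); last first.
  exists G; rewrite add0n; split=> // [d0|i||i id].
  - have := Glt _ d0; rewrite expr0 mulr1; apply: le_lt_trans.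
    by rewrite coef0_rev_root_poly vabs1.
  - rewrite coef_rev_root_poly_cons vabsB_le//.
    case: i => [|i]; first by rewrite vabs0 expr0 mulr1 ltW.
    by rewrite vabsM exprS mulrCA ler_pM ?vabs_ge0.
  - rewrite coef_rev_root_poly_cons vabsB_gt// Geq.
    case: d Glt {Geq} => [|d] Glt; first by rewrite vabs0 expr0 mulr1.
    rewrite vabsM exprS mulrCA (@le_lt_trans _ _ (r * vabs (rev_root_poly u)`_d))//.
      by rewrite ler_wpM2r ?vabs_ge0.
    by rewrite ltr_pM2l// Glt.
  - rewrite coef_rev_root_poly_cons (le_lt_trans (vabsD _ _))// gt_max Glt//= vabsN.
    case: i id => [|i] id; first by rewrite vabs0 expr0 mulr1.
    rewrite vabsM exprS mulrCA (@le_lt_trans _ _ (r * vabs (rev_root_poly u)`_i))//.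
      by rewrite ler_wpM2r ?vabs_ge0.
    by rewrite ltr_pM2l// Glt// ltnW.
have tr1 : 1 < vabs t / r by rewrite ltr_pdivlMr ?mul1r.
have GG : G < G * (vabs t / r) by rewrite ltr_pMr.
have GS i : G * (vabs t / r) * r ^+ i.+1 = vabs t * (G * r ^+ i).
  by rewrite exprS; field; rewrite gt_eqF.
have t0 : 0 < vabs t by exact: lt_trans rt.
exists (G * (vabs t / r)); rewrite add1n; split.
- exact: le_trans (ltW GG).
- by move=> _; exact: le_lt_trans GG.
- move=> i; rewrite coef_rev_root_poly_cons vabsB_le//.
    by rewrite (le_trans (Gle i))// ler_pM2r// ltW.
  case: i => [|i]; first by rewrite vabs0 expr0 mulr1 ltW// (lt_trans _ GG).
  by rewrite vabsM GS ler_pM2l.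
- rewrite coef_rev_root_poly_cons -vabsN opprB vabsB_gt vabsM Geq -GS//.
  by rewrite (le_lt_trans (Gle _))// ltr_pM2r.
- move=> i id; rewrite coef_rev_root_poly_cons (le_lt_trans (vabsD _ _))// gt_max.
  rewrite (le_lt_trans (Gle i)) ?ltr_pM2r//= vabsN.
  case: i id => [|i] id; first by rewrite vabs0 expr0 mulr1 (lt_trans _ GG).
  by rewrite vabsM GS ltr_pM2l// Glt.
Qed.

(** If the vertices differed, the largest weighted coefficient of one of the two
    polynomials would survive in their difference. At index [k <= n] it exceeds
    [r ^+ k], hence [r ^+ n]. *)
Lemma count_large_le n m u v r : 0 < r -> r <= 1 -> (m <= n)%N ->
  size u = m -> size v = m ->
  (forall k, (k <= n)%N ->
    vabs ((rev_root_poly u)`_k - (rev_root_poly v)`_k) <= r ^+ n) ->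
  (count (fun t => (r < vabs t)%R) v <= count (fun t => (r < vabs t)%R) u)%N.
Proof.
move=> r0 r1 mn su sv huv.
have [Gu [Gu1 _ Gule Gueq Gult]] := newton_vertex u r0.
have [Gv [Gv1 Gv1' Gvle Gveq Gvlt]] := newton_vertex v r0.
set i := count _ u in Gueq Gult *; set j := count _ v in Gv1' Gveq Gvlt *.
rewrite leqNgt; apply/negP => ij.
have jn : (j <= n)%N by rewrite (leq_trans _ mn)// -sv count_size.
have Gvgt1 : 1 < Gv by apply: Gv1'; exact: leq_ltn_trans ij.
have rX k : 0 < r ^+ k by exact: exprn_gt0.
have absurd G k : 1 < G -> (k <= n)%N -> G * r ^+ k <= r ^+ n -> False.
  move=> G1 kn; rewrite -(subnK kn) exprD ler_pM2r// => /(lt_le_trans G1).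
  by rewrite ltNge exprn_ile1// ltW.
have [GuGv|GvGu] := ltP Gu Gv.
  apply: (absurd Gv j) => //; rewrite -Gveq -(@vabsB_gt _ (rev_root_poly u)`_j).
    by rewrite vabsB_sym huv.
  by rewrite Gveq (le_lt_trans (Gule j))// ltr_pM2r.
have ik : (i <= n)%N by rewrite (leq_trans _ jn)// ltnW.
apply: (absurd Gu i) => //; first exact: lt_le_trans GvGu.
rewrite -Gueq -(@vabsB_gt _ (rev_root_poly v)`_i) ?huv//.
by rewrite Gueq (lt_le_trans (Gvlt i ij))// ler_pM2r.
Qed.

Lemma power_sum_translate_close n u v a r : 0 <= r -> vabs a <= 1 ->
  size u = size v ->
  (forall k, (0 < k <= n)%N -> vabs (power_sum u k - power_sum v k) <= r) ->
  forall k, (k <= n)%N ->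
  vabs (power_sum [seq t - a | t <- u] k - power_sum [seq t - a | t <- v] k) <= r.
Proof.
move=> r0 a1 suv huv k kn.
have E w : power_sum [seq t - a | t <- w] k =
    \sum_(i < k.+1) ((- a) ^+ i *+ 'C(k, i)) * power_sum w (k - i).
  rewrite /power_sum big_map; under eq_bigr do rewrite exprDn.
  rewrite exchange_big/=; apply: eq_bigr => i _; rewrite mulr_sumr.
  by apply: eq_bigr => t _; rewrite mulrnAl -mulrnAr mulrC mulrnAl -mulrnAr.
rewrite !E -sumrB vabs_sum_le// => i _; rewrite -mulrBr vabsM_le1//.
  by rewrite -mulr_natr vabsM_le1 ?vabs_expr_le1 ?vabs_natr_le1// vabsN.
have [->|ki] := eqVneq (k - i)%N 0%N; last first.
  by rewrite huv// lt0n ki/= (leq_trans (leq_subr _ _)).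
have p0 w : @power_sum K w 0 = (size w)%:R.
  by rewrite /power_sum big_const_seq count_predT iter_addr_0.
by rewrite !p0 suv subrr vabs0.
Qed.

(** Translating by [a] keeps the power sums close, so by Newton's identities the
    two polynomials are close, and closeness to precision [r ^+ n] with
    [m <= n] pins down the vertex of their Newton polygons. *)
Lemma count_ball_eq n m u v r a : 0 < r -> r <= 1 -> (m <= n)%N ->
  (forall k, (0 < k <= n)%N -> vabs (k%:R : K) = 1) ->
  {in u, forall t, vabs t <= 1} -> {in v, forall t, vabs t <= 1} ->
  vabs a <= 1 -> size u = m -> size v = m ->
  (forall k, (0 < k <= n)%N ->
    vabs (power_sum u k - power_sum v k) <= r ^+ n) ->
  count (fun t => vabs (t - a) <= r) u = count (fun t => vabs (t - a) <= r) v.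
Proof.
move=> r0 r1 mn nat1 hu hv a1 su sv huv.
have rn0 : 0 <= r ^+ n by rewrite exprn_ge0// ltW.
have hc : forall k, (k <= n)%N ->
    vabs ((rev_root_poly [seq t - a | t <- u])`_k -
          (rev_root_poly [seq t - a | t <- v])`_k) <= r ^+ n.
  apply: coef_rev_root_poly_close => //.
  - by move=> _ /mapP[t /hu t1 ->]; exact: vabsB_le.
  - by move=> _ /mapP[t /hv t1 ->]; exact: vabsB_le.
  - move=> k /andP[_ kn]; apply: (power_sum_translate_close _ _ _ huv) => //.
    by rewrite su sv.
have E w : count (fun t => vabs (t - a) <= r) w =
    (size w - count (fun t => (r < vabs t)%R) [seq (t - a)%R | t <- w])%N.
  rewrite count_map -(count_predC (fun t => (r < vabs (t - a))%R) w).
  by rewrite addKn; apply: eq_count => t /=; rewrite leNgt.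
rewrite !E su sv; congr (_ - _)%N; apply/eqP; rewrite eqn_leq.
rewrite !(@count_large_le n m)// ?size_map// => k kn.
by rewrite vabsB_sym hc.
Qed.

End Ultrametric.

(** * Biorthogonality of products *)

Section Biorthogonality.
Context {C : numClosedFieldType} {W Omega : finType} {m : nat}.
Implicit Types (phi psi : {ffun 'I_m -> W}).

Lemma card_rearrangements phi :
  (#|[pred psi : {ffun 'I_m -> W} |
      perm_eq [tuple psi i | i < m] [tuple phi i | i < m]]| <= m`!)%N.
Proof.
rewrite -card_Sn.
apply: leq_trans (leq_imset_card (fun s : {perm 'I_m} => [ffun i => phi (s i)]) 'S_m).
rewrite subset_leq_card//; apply/fintype.subsetP => psi.
rewrite inE => /tuple_permP[s /val_inj E].
apply/imsetP; exists s => //.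
apply/ffunP => i; rewrite ffunE.
by have := congr1 (fun t => tnth t i) E; rewrite !tnth_mktuple.
Qed.

Lemma expr_sum_ffun (G : W -> C) :
  (\sum_w G w) ^+ m = \sum_(phi : {ffun 'I_m -> W}) \prod_i G (phi i).
Proof.
rewrite -[m in LHS]card_ord -prodr_const.
by rewrite (bigA_distr_bigA (fun (_ : 'I_m) w => G w)).
Qed.

(** Expanding the [2m]-th power of a sum into products, only the pairs of index
    tuples that are rearrangements of each other survive, and then the two
    products coincide. Each tuple has at most [m!] rearrangements. *)
Lemma sum_norm_pow_le_square_function (F : W -> Omega -> C) :
  (forall phi psi,
     ~~ perm_eq [tuple psi i | i < m] [tuple phi i | i < m] ->
     \sum_o (\prod_i F (phi i) o) * (\prod_i F (psi i) o)^* = 0) ->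
  \sum_o `|\sum_w F w o| ^+ (2 * m) <=
  m`!%:R * \sum_o (\sum_w `|F w o| ^+ 2) ^+ m.
Proof.
move=> orth; pose P phi o := \prod_i F (phi i) o.
have Peq phi psi o : perm_eq [tuple psi i | i < m] [tuple phi i | i < m] ->
    P psi o = P phi o.
  have PE (X : {ffun 'I_m -> W}) : P X o = \prod_(w <- [tuple X i | i < m]) F w o.
    by rewrite big_map big_enum.
  by move=> h; rewrite !PE; exact: perm_big.
have -> : \sum_o `|\sum_w F w o| ^+ (2 * m) =
    \sum_phi \sum_psi \sum_o P phi o * (P psi o)^*.
  transitivity (\sum_o \sum_phi \sum_psi P phi o * (P psi o)^*); last first.
    by rewrite exchange_big; apply: eq_bigr => phi _; rewrite exchange_big.
  apply: eq_bigr => o _; rewrite exprM normCK exprMn -rmorphXn/= expr_sum_ffun.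
  by rewrite mulr_suml; apply: eq_bigr => phi _; rewrite rmorph_sum mulr_sumr.
have -> : \sum_o (\sum_w `|F w o| ^+ 2) ^+ m =
    \sum_phi \sum_o P phi o * (P phi o)^*.
  rewrite exchange_big/=; apply: eq_bigr => o _; rewrite expr_sum_ffun.
  apply: eq_bigr => phi _; rewrite /P rmorph_prod -big_split/=.
  by apply: eq_bigr => i _; rewrite normCK.
rewrite mulr_sumr ler_sum// => phi _.
rewrite (bigID (fun psi => perm_eq [tuple psi i | i < m] [tuple phi i | i < m]))/=.
rewrite [X in _ + X]big1 ?addr0; last by move=> psi /orth.
rewrite (eq_bigr (fun _ => \sum_o P phi o * (P phi o)^*)); last first.
  by move=> psi psiphi; apply: eq_bigr => o _; rewrite (Peq phi psi).
rewrite sumr_const -[leLHS]mulr_natl ler_wpM2r ?ler_nat ?card_rearrangements//.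
by apply: sumr_ge0 => o _; exact: mul_conjC_ge0.
Qed.

End Biorthogonality.

Section BlockBiorthogonality.
Context {C : numClosedFieldType} {V W Omega : finType} {m : nat}.

(** A product of block sums expands, by multilinearity, into products of
    elementary terms lying in the prescribed blocks, so orthogonality need only
    be known for the elementary functions [chi v]. *)
Lemma block_sum_norm_pow_le (par : V -> W) (kappa : V -> C)
    (chi : V -> Omega -> C) :
  (forall phi psi : {ffun 'I_m -> V},
     ~~ perm_eq [tuple par (psi i) | i < m] [tuple par (phi i) | i < m] ->
     \sum_o (\prod_i chi (phi i) o) * (\prod_i chi (psi i) o)^* = 0) ->
  \sum_o `|\sum_v kappa v * chi v o| ^+ (2 * m) <=
  m`!%:R * \sum_o (\sum_w `|\sum_(v | par v == w) kappa v * chi v o| ^+ 2) ^+ m.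
Proof.
move=> orth.
under eq_bigr do rewrite (partition_big par predT)//=.
apply: sum_norm_pow_le_square_function => Phi Psi PhiPsi.
pose T (phi : {ffun 'I_m -> V}) o := \prod_i (kappa (phi i) * chi (phi i) o).
pose fam (X : {ffun 'I_m -> W}) := family (fun i => [pred v | par v == X i]).
have E (X : {ffun 'I_m -> W}) o :
    \prod_i \sum_(v | par v == X i) kappa v * chi v o =
    \sum_(phi in fam X) T phi o.
  exact: (bigA_distr_big_dep (fun i v => par v == X i)
            (fun i v => kappa v * chi v o)).
under eq_bigr do rewrite !E rmorph_sum mulr_suml.
rewrite exchange_big big1// => phi phiPhi.
under eq_bigr do rewrite mulr_sumr.
rewrite exchange_big big1// => psi psiPsi.
have tupE (X : {ffun 'I_m -> W}) xi : xi \in fam X ->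
    [tuple par (xi i) | i < m] = [tuple X i | i < m].
  by move=> /familyP xiX; apply: eq_mktuple => i; have := xiX i; rewrite inE => /eqP.
have h : ~~ perm_eq [tuple par (psi i) | i < m] [tuple par (phi i) | i < m].
  by rewrite (tupE _ _ phiPhi) (tupE _ _ psiPsi).
rewrite /T; under eq_bigr do rewrite !big_split/= rmorphM mulrACA.
by rewrite -mulr_sumr orth// mulr0.
Qed.

End BlockBiorthogonality.

(** * Finite nets in the ring of integers *)

Section LocalField.
Context {R : realType} {K : nonArchFieldType R}.
Implicit Types (s : seq K) (r : R) (x y : K).

(** A complete system of representatives of the ring of integers modulo the
    ideal of elements of absolute value at most [r]. *)
Definition separated_net s r : Prop :=
  [/\ {in s, forall a, vabs a <= 1},
      forall x, vabs x <= 1 -> exists2 a, a \in s & vabs (x - a) <= r &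
      {in s &, forall a b, vabs (a - b) <= r -> a = b}].

(** Being within distance [r] is transitive, so a finite covering family can be
    thinned out greedily to a separated one that still covers. *)
Lemma separated_subseq s r : 0 <= r -> exists s',
  [/\ {subset s' <= s},
      {in s, forall x, exists2 a, a \in s' & vabs (x - a) <= r} &
      {in s' &, forall a b, vabs (a - b) <= r -> a = b}].
Proof.
move=> r0; elim: s => [|x s [s' [s's cov sep]]]; first by exists [::].
have [/hasP[a as' xa]|/hasPn far] := boolP (has (fun a => vabs (x - a) <= r) s').
  exists s'; split=> // b; rewrite inE; first by move=> /s's ->; rewrite orbT.
  by move=> /orP[/eqP->|/cov//]; exists a.
exists (x :: s'); split=> [b|b|a b]; rewrite !inE.
- by move=> /orP[->//|/s's ->]; rewrite orbT.
- move=> /orP[/eqP->|/cov[a as' ba]].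
    by exists x; rewrite ?mem_head// subrr vabs0.
  by exists a; rewrite // inE as' orbT.
- move=> /orP[/eqP->|as'] /orP[/eqP->|bs'] //.
  + by rewrite (negPf (far _ bs')).
  + by rewrite vabsB_sym (negPf (far _ as')).
  + exact: sep.
Qed.

Section Uniformiser.
Context (pi : K) (K_local : local_field K) (pi_unif : is_uniformiser pi).

Lemma uniformiser_lt1 : vabs pi < 1.
Proof.
suff : maximal_ideal K pi by [].
by rewrite pi_unif; exists 1; rewrite ?mulr1// /ring_of_integers/= vabs1.
Qed.

Lemma vabs_lt1_le_uniformiser x : vabs x < 1 -> vabs x <= vabs pi.
Proof.
move=> x1; have : maximal_ideal K x by [].
rewrite pi_unif => -[y y1 <-]; rewrite mulrC.
exact: vabsM_le1.
Qed.

Lemma uniformiser_gt0 : 0 < vabs pi.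
Proof.
rewrite lt_neqAle vabs_ge0 andbT; apply/negP => /eqP/esym/vabs_eq0 pi0.
have small0 x : vabs x < 1 -> x = 0.
  by move=> /vabs_lt1_le_uniformiser; rewrite pi0 vabs0 => x0;
    apply/vabs_eq0/le_anti; rewrite x0 vabs_ge0.
have [x [x0 x1]] := vabs_nontrivial K_local.
have vx0 : vabs x != 0 by apply: contra_neq x0 => /vabs_eq0.
have [lt1|gt1|eq1] := ltgtP (vabs x) 1.
- by rewrite (small0 _ lt1) eqxx in x0.
- have /eqP : x^-1 = 0 by apply: small0; rewrite vabsV invf_lt1// lt_neqAle eq_sym vx0 vabs_ge0.
  by rewrite invr_eq0 (negPf x0).
- by rewrite eq1 eqxx in x1.
Qed.

Lemma uniformiser_neq0 : pi != 0.
Proof. by apply: contraTN uniformiser_gt0 => /eqP ->; rewrite vabs0 ltxx. Qed.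

(** The gap between [vabs pi] and [1] in the value group, multiplied by
    [vabs x]. *)
Lemma vabs_gt_uniformiserX x N :
  vabs pi ^+ N < vabs x -> vabs pi ^+ N <= vabs pi * vabs x.
Proof.
move=> piNx; have x0 : 0 < vabs x by rewrite (le_lt_trans _ piNx)// exprn_ge0 ?vabs_ge0.
have := @vabs_lt1_le_uniformiser (pi ^+ N / x).
rewrite vabsM vabsV vabsX ltr_pdivrMr// mul1r => /(_ piNx).
by rewrite ler_pdivrMr.
Qed.

Lemma residue_piE (a b : val_ring K) :
  (\pi_(residue_field K) a == \pi b)%qT = (vabs (val a - val b) < 1).
Proof. by rewrite -Quotient.idealrBE inE. Qed.

Lemma vabs_natr_eq1 n :
  (exists2 p : nat, p \in [pchar (residue_field K)] & (n < p)%N) ->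
  forall k, (0 < k <= n)%N -> vabs (k%:R : K) = 1.
Proof.
move=> [p charp np] k /andP[k0 kn]; apply/eqP; rewrite eq_le vabs_natr_le1 leNgt/=.
apply/negP => k1.
have : (k%:R : residue_field K) == 0.
  rewrite -(rmorph_nat (\pi_(residue_field K))%qT) -(rmorph0 (\pi_(residue_field K))%qT).
  by rewrite residue_piE subr0 rmorph_nat.
rewrite -(dvdn_pcharf charp) => /dvdn_leq-/(_ k0).
by rewrite leqNgt (leq_ltn_trans kn np).
Qed.

(** Digit expansions: [N] successive digits, each one of finitely many
    representatives of the residue field, locate an integer up to
    [vabs pi ^+ N]. *)
Lemma finite_cover N : exists s,
  {in s, forall a, vabs a <= 1} /\
  forall x, vabs x <= 1 -> exists2 a, a \in s & vabs (x - a) <= vabs pi ^+ N.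
Proof.
elim: N => [|N [s [s1 scov]]].
  exists [:: 0]; split=> [a|x x1]; first by rewrite inE => /eqP->; rewrite vabs0.
  by exists 0; rewrite ?inE// subr0 expr0.
have /finite_seqP[c cE] := residue_field_finite K_local.
pose d := [seq val (repr z : val_ring K) | z <- c].
exists [seq a + pi * b | a <- d, b <- s]; split=> [_ /allpairsP[[a b]/= [ad bs ->]]|x x1].
  have /mapP[z _ ->] := ad; apply: vabsD_le; first by case: (repr z).
  by rewrite (vabsM_le1 _ (s1 _ bs))// ltW// uniformiser_lt1.
pose x' : val_ring K := ValRing x1.
pose a := val (repr (\pi_(residue_field K) x')%qT : val_ring K).
have ad : a \in d.
  apply/mapP; exists (\pi x')%qT => //.
  have : [set: residue_field K] (\pi x')%qT by [].
  by rewrite cE.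
have xa : vabs (x - a) <= vabs pi.
  apply: vabs_lt1_le_uniformiser; rewrite -[x]/(val x') -residue_piE.
  by rewrite reprK.
have pi0 := uniformiser_gt0.
have [|b bs xab] := scov ((x - a) / pi).
  by rewrite vabsM vabsV ler_pdivrMr// mul1r.
exists (a + pi * b); first exact: allpairs_f.
have -> : x - (a + pi * b) = pi * ((x - a) / pi - b).
  by field; exact: uniformiser_neq0.
by rewrite vabsM exprS ler_pM2l.
Qed.

Lemma exists_separated_net N : exists s, separated_net s (vabs pi ^+ N).
Proof.
have [s [s1 scov]] := finite_cover N.
have [|s' [s's cov sep]] := @separated_subseq s (vabs pi ^+ N).
  by rewrite exprn_ge0 ?vabs_ge0.
exists s'; split=> // [a /s's/s1//|x /scov[b /cov[a as' ba] xb]].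
by exists a => //; exact: vabsB_trans ba.
Qed.

End Uniformiser.
End LocalField.

(** * Orthogonality of characters on the moment curve *)

Lemma normc_cabs {R : realType} (z : R[i]) : `|z| = (cabs z)%:C%C.
Proof. by case: z. Qed.

Section Character.
Context {R : realType} {K : nonArchFieldType R} (pi : K) (e : K -> R[i]).
Context (K_local : local_field K) (pi_unif : is_uniformiser pi)
  (e_char : standard_character pi e).
Context {n : nat}.

Definition phase (y : n.-tuple K) (t : K) : K :=
  \sum_(i < n) tnth y i * t ^+ i.+1.

Lemma char0 : e 0 = 1.
Proof. by rewrite (char_trivial e_char)// /ring_of_integers/= vabs0. Qed.

Lemma char_sum (I : Type) (r : seq I) (P : pred I) (F : I -> K) :
  e (\sum_(i <- r | P i) F i) = \prod_(i <- r | P i) e (F i).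
Proof. exact: (big_morph e (char_add e_char) char0). Qed.

Lemma char_conj x : (e x)^* = e (- x).
Proof.
have eN : e x * e (- x) = 1 by rewrite -(char_add e_char) subrr char0.
have e0 : e x != 0.
  by apply: contra_eq_neq eN => ->; rewrite mul0r eq_sym oner_eq0.
apply: (mulfI e0); rewrite eN -normCK normc_cabs (char_unitary e_char).
by rewrite expr1n.
Qed.

Lemma char_eq_close x y : vabs (x - y) <= 1 -> e x = e y.
Proof.
move=> xy; rewrite -(subrK y x) (char_add e_char) (char_trivial e_char)//.
by rewrite mul1r.
Qed.

(** The sum is over a transversal of a finite group, on which
    [w |-> e (w * xi)] is a well-defined character; it is nontrivial, so the sum
    is invariant under multiplication by some value different from [1]. *)
Lemma char_net_sum0 s N xi : separated_net s (vabs pi ^+ N) ->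
  vabs xi <= 1 -> vabs pi ^+ N < vabs xi ->
  \sum_(b : seq_sub s) e (pi ^- N * val b * xi) = 0.
Proof.
move=> [s1 scov ssep] xi1 Nxi.
have pi0 := uniformiser_gt0 K_local pi_unif.
have piN0 : 0 < vabs pi ^+ N by exact: exprn_gt0.
have xigt0 : 0 < vabs xi by exact: lt_trans Nxi.
have xi0 : xi != 0 by apply: contraTN xigt0 => /eqP->; rewrite vabs0 ltxx.
have pin0 := uniformiser_neq0 K_local pi_unif.
have piNn0 : pi ^+ N != 0 by rewrite expf_neq0.
have [x0 x01 ex0] := char_nonprincipal e_char.
(* A multiple at which the character takes a value different from [1]; it lies
   in the group because [vabs pi ^+ N <= vabs pi * vabs xi]. *)
pose w0 := pi^-1 * x0 / xi.
have w0xi : w0 * xi = pi^-1 * x0 by rewrite /w0 divfK.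
have piw0 : vabs (pi ^+ N * w0) <= 1.
  rewrite /w0 !vabsM vabsX !vabsV mulrA ler_pdivrMr// mul1r.
  rewrite mulrCA ler_pdivrMl// (le_trans _ (vabs_gt_uniformiserX pi_unif Nxi))//.
  by rewrite ler_piMr// ltW.
have /choice[sigma sigmaP] : forall b : seq_sub s, exists b' : seq_sub s,
    vabs (val b + pi ^+ N * w0 - val b') <= vabs pi ^+ N.
  move=> b; have [|a as_ ha] := scov (val b + pi ^+ N * w0).
    by rewrite vabsD_le// s1 ?ssvalP.
  by exists (SeqSub as_).
have sigma_inj : injective sigma.
  move=> b c sbc; apply/val_inj/ssep; rewrite ?ssvalP//.
  have := vabsB_le (sigmaP b) (sigmaP c).
  by rewrite sbc opprB addrA subrK opprD addrA addrAC addrK.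
set S := \sum_b _; have : S = e (w0 * xi) * S.
  rewrite /S {1}(reindex_inj sigma_inj) mulr_sumr; apply: eq_bigr => b _.
  rewrite -(char_add e_char); apply: char_eq_close.
  have -> : pi ^- N * val (sigma b) * xi - (w0 * xi + pi ^- N * val b * xi) =
      xi * (- (val b + pi ^+ N * w0 - val (sigma b)) / pi ^+ N) by field.
  apply: vabsM_le1 => //.
  by rewrite vabsM vabsN vabsV vabsX ler_pdivrMr// mul1r.
move=> /eqP; rewrite -subr_eq0 -{1}[S]mul1r -mulrBl mulf_eq0 subr_eq0 w0xi.
by rewrite eq_sym (negPf ex0)/= => /eqP.
Qed.

(** As [o] varies these points represent the cosets of the integral points of
    [K^n] in the ball of radius [vabs pi ^- N] around [x]. *)
Definition net_point s N (x : n.-tuple K) (o : {ffun 'I_n -> seq_sub s}) :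
    n.-tuple K :=
  [tuple tnth x i + pi ^- N * val (o i) | i < n].

Lemma char_box_sum0 s N (x : n.-tuple K) (xi : 'I_n -> K) i0 :
  separated_net s (vabs pi ^+ N) ->
  (forall i, vabs (xi i) <= 1) -> vabs pi ^+ N < vabs (xi i0) ->
  \sum_(o : {ffun 'I_n -> seq_sub s})
    e (\sum_(i < n) tnth (net_point N x o) i * xi i) = 0.
Proof.
move=> snet xi1 xi0.
transitivity (\prod_(i < n) \sum_(b : seq_sub s)
    e ((tnth x i + pi ^- N * val b) * xi i)).
  rewrite (bigA_distr_bigA (fun i b => e ((tnth x i + pi ^- N * val b) * xi i))).
  apply: eq_bigr => o _; rewrite char_sum; apply: eq_bigr => i _.
  by rewrite tnth_mktuple.
rewrite (bigD1 i0)//= [X in X * _](_ : _ = 0) ?mul0r//.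
transitivity (e (tnth x i0 * xi i0) * \sum_(b : seq_sub s) e (pi ^- N * val b * xi i0)).
  rewrite mulr_sumr; apply: eq_bigr => b _.
  by rewrite mulrDl (char_add e_char).
by rewrite (char_net_sum0 snet)// mulr0.
Qed.

Lemma char_phase_prod m (y : n.-tuple K) (phi psi : 'I_m -> K) :
  (\prod_i e (phase y (phi i))) * (\prod_i e (phase y (psi i)))^* =
  e (\sum_(k < n) tnth y k *
      (power_sum [seq phi i | i <- enum 'I_m] k.+1 -
       power_sum [seq psi i | i <- enum 'I_m] k.+1)).
Proof.
rewrite -!char_sum char_conj -(char_add e_char); congr e.
rewrite /phase exchange_big [X in _ - X]exchange_big -sumrB.
apply: eq_bigr => k _; rewrite mulrBr -!mulr_sumr.
by rewrite /power_sum (big_map phi) (big_map psi) !big_enum.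
Qed.

(** A product of [m] characters along the moment curve against the conjugate of
    another one has frequency given by differences of power sums. Either the
    sum over the box kills it, or all power sums agree to precision
    [vabs pi ^+ (alpha * n)], and then [count_ball_eq] matches the balls. *)
Lemma discrete_decoupling alpha m sa sN sM (x : n.-tuple K)
    (par : seq_sub sM -> seq_sub sa) (kappa : seq_sub sM -> R[i]) :
  (forall k, (0 < k <= n)%N -> vabs (k%:R : K) = 1) -> (m <= n)%N ->
  separated_net sa (vabs pi ^+ alpha) ->
  separated_net sN (vabs pi ^+ (alpha * n)) ->
  {in sM, forall t, vabs t <= 1} ->
  (forall v, vabs (val v - val (par v)) <= vabs pi ^+ alpha) ->
  \sum_(o : {ffun 'I_n -> seq_sub sN})
    `|\sum_v kappa v * e (phase (net_point (alpha * n) x o) (val v))| ^+ (2 * m)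
  <= m`!%:R * \sum_(o : {ffun 'I_n -> seq_sub sN})
    (\sum_w `|\sum_(v | par v == w)
      kappa v * e (phase (net_point (alpha * n) x o) (val v))| ^+ 2) ^+ m.
Proof.
move=> nat1 mn [sa1 _ sasep] sNnet sM1 parP.
apply: (@block_sum_norm_pow_le _ _ _ _ _ par kappa
  (fun v o => e (phase (net_point (alpha * n) x o) (val v)))).
move=> phi psi nperm; under eq_bigr do rewrite char_phase_prod.
pose U (X : {ffun 'I_m -> seq_sub sM}) := [seq val (X i) | i <- enum 'I_m].
have U1 X : {in U X, forall t, vabs t <= 1}.
  by move=> _ /mapP[i _ ->]; rewrite sM1 ?ssvalP.
have [/existsP[k0 k0P]|/existsPn small] := boolP [exists k : 'I_n,
    vabs pi ^+ (alpha * n) < vabs (power_sum (U phi) k.+1 - power_sum (U psi) k.+1)].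
  apply: (char_box_sum0 _ sNnet _ k0P) => i.
  by apply: vabsB_le; apply: vabs_sum_seq_le => // t /U1; exact: vabs_expr_le1.
case/negP: nperm; rewrite /perm_eq; apply/allP => w _ /=.
have cntE (X : {ffun 'I_m -> seq_sub sM}) : count_mem w [tuple par (X i) | i < m] =
    count (fun t => vabs (t - val w) <= vabs pi ^+ alpha) (U X).
  rewrite /= !count_map; apply: eq_count => i /=.
  apply/eqP/idP => [<-|close]; first exact: parP.
  apply: val_inj; apply: sasep; rewrite ?ssvalP//.
  by apply: vabsB_trans close; rewrite vabsB_sym; exact: parP.
have pi0 := uniformiser_gt0 K_local pi_unif.
rewrite !cntE; apply/eqP/(@count_ball_eq _ _ n m) => //.
- exact: exprn_gt0.
- by rewrite exprn_ile1// ?ltW// uniformiser_lt1.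
- by rewrite sa1 ?ssvalP.
- by rewrite size_map size_enum_ord.
- by rewrite size_map size_enum_ord.
- move=> [//|k]/= kn; rewrite vabsB_sym -exprM leNgt.
  exact: (small (Ordinal kn)).
Qed.

End Character.

(** * Integration over small balls *)

Lemma big_indic {Z : pzRingType} {T : Type} {I : finType} (P : pred I)
    (A : I -> set T) (c : I -> Z) y i0 :
  (forall i j, A i y -> A j y -> i = j) -> A i0 y ->
  \sum_(i | P i) c i * \1_(A i) y = c i0 *+ P i0.
Proof.
move=> disj Ay; have A0 i : i != i0 -> c i * \1_(A i) y = 0.
  move=> ii0; rewrite indicE memNset ?mulr0// => Aiy.
  by move/eqP: ii0; apply; exact: disj.
have [Pi0|nPi0] := boolP (P i0); last first.
  by rewrite big1// => i Pi; apply: A0; apply: contraNneq nPi0 => <-.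
rewrite (bigD1 i0)//= indicE mem_set// mulr1 big1 ?addr0// => i /andP[_].
exact: A0.
Qed.

Section ComplexLinearity.
Context d (T : measurableType d) (R : realType).
Context (mu : {measure set T -> \bar R}) (D : set T)
  (mD : measurable D).
Implicit Types (g h : T -> R[i]) (z : R[i]).

Definition cintegrable g : Prop :=
  mu.-integrable D (EFin \o (fun t => complex.Re (g t))) /\
  mu.-integrable D (EFin \o (fun t => complex.Im (g t))).

Lemma eq_cintegral g h : {in D, g =1 h} ->
  cintegral mu D g = cintegral mu D h.
Proof.
by move=> gh; congr Complex; apply: eq_Rintegral => t tD; rewrite gh.
Qed.

Lemma cintegrable0 : cintegrable (fun=> 0).
Proof. by split; exact: integrable0. Qed.

Lemma cintegrableD g h : cintegrable g -> cintegrable h ->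
  cintegrable (fun t => g t + h t).
Proof.
move=> [gr gi] [hr hi]; split.
  rewrite (_ : _ \o _ = (EFin \o (fun t => complex.Re (g t))) \+
                        (EFin \o (fun t => complex.Re (h t))))%E.
    exact: integrableD.
  by apply/funext => t /=; case: (g t) => a b; case: (h t).
rewrite (_ : _ \o _ = (EFin \o (fun t => complex.Im (g t))) \+
                      (EFin \o (fun t => complex.Im (h t))))%E.
  exact: integrableD.
by apply/funext => t /=; case: (g t) => a b; case: (h t).
Qed.

Lemma cintegralD g h : cintegrable g -> cintegrable h ->
  cintegral mu D (fun t => g t + h t) = cintegral mu D g + cintegral mu D h.
Proof.
move=> [gr gi] [hr hi]; congr Complex.
  rewrite -RintegralD//; apply: eq_Rintegral => t _.
  by case: (g t) => a b; case: (h t).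
rewrite -RintegralD//; apply: eq_Rintegral => t _.
by case: (g t) => a b; case: (h t).
Qed.

Lemma integrable_lincomb (a b : R) (u v : T -> R) :
  mu.-integrable D (EFin \o u) -> mu.-integrable D (EFin \o v) ->
  mu.-integrable D (EFin \o (fun t => a * u t + b * v t)).
Proof.
move=> iu iv.
have := integrableD mD (integrableZl mD a iu) (integrableZl mD b iv).
exact: eq_integrable.
Qed.

Lemma Rintegral_lincomb (a b : R) (u v : T -> R) :
  mu.-integrable D (EFin \o u) -> mu.-integrable D (EFin \o v) ->
  \int[mu]_(t in D) (a * u t + b * v t) =
  a * \int[mu]_(t in D) u t + b * \int[mu]_(t in D) v t.
Proof.
move=> iu iv; rewrite RintegralD ?RintegralZl//.
  exact: eq_integrable (integrableZl mD a iu).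
exact: eq_integrable (integrableZl mD b iv).
Qed.

Lemma cintegrableZ z g : cintegrable g -> cintegrable (fun t => z * g t).
Proof.
case: z => a b [gr gi]; split.
  apply: eq_integrable (integrable_lincomb a (- b) gr gi) => // t _ /=.
  by case: (g t) => u v /=; rewrite mulNr.
apply: eq_integrable (integrable_lincomb a b gi gr) => // t _ /=.
by case: (g t) => u v /=.
Qed.

Lemma cintegralZ z g : cintegrable g ->
  cintegral mu D (fun t => z * g t) = z * cintegral mu D g.
Proof.
case: z => a b [gr gi]; rewrite /cintegral; congr Complex.
  rewrite -mulNr -Rintegral_lincomb//; apply: eq_Rintegral => t _.
  by case: (g t) => u v /=; rewrite mulNr.
rewrite -Rintegral_lincomb//; apply: eq_Rintegral => t _.
by case: (g t) => u v /=.
Qed.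

Lemma cintegral_sum (I : Type) (s : seq I) (P : pred I) (z : I -> R[i])
    (g : I -> T -> R[i]) :
  (forall i, cintegrable (g i)) ->
  cintegral mu D (fun t => \sum_(i <- s | P i) z i * g i t) =
  \sum_(i <- s | P i) z i * cintegral mu D (g i).
Proof.
move=> ig; suff [] : cintegrable (fun t => \sum_(i <- s | P i) z i * g i t) /\
  cintegral mu D (fun t => \sum_(i <- s | P i) z i * g i t) =
  \sum_(i <- s | P i) z i * cintegral mu D (g i) by [].
elim: s => [|i s [IH1 IH2]].
  rewrite big_nil (_ : (fun _ => _) = fun=> 0); last first.
    by apply/funext => t; rewrite big_nil.
  split; first exact: cintegrable0.
  by congr Complex; rewrite Rintegral_cst// mul0r.
rewrite big_cons.
have [Pi|nPi] := boolP (P i); last first.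
  rewrite (_ : (fun _ => _) = fun t => \sum_(j <- s | P j) z j * g j t)//.
  by apply/funext => t; rewrite big_cons (negPf nPi).
rewrite (_ : (fun _ => _) =
    fun t => z i * g i t + \sum_(j <- s | P j) z j * g j t); last first.
  by apply/funext => t; rewrite big_cons Pi.
split; first by apply: cintegrableD => //; exact: cintegrableZ.
by rewrite cintegralD ?cintegralZ ?IH2//; exact: cintegrableZ.
Qed.

Lemma normr_Re_le_cabs z : `|complex.Re z| <= cabs z.
Proof.
case: z => a b /=; rewrite -sqrtr_sqr /cabs /= ler_wsqrtr//.
by rewrite lerDl sqr_ge0.
Qed.

Lemma normr_Im_le_cabs z : `|complex.Im z| <= cabs z.
Proof.
case: z => a b /=; rewrite -sqrtr_sqr /cabs /= ler_wsqrtr//.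
by rewrite lerDr sqr_ge0.
Qed.

Lemma L1_cintegrable g : L1 mu D g -> cintegrable g.
Proof.
move=> [mr mi gfin].
have mabs : measurable_fun D (fun t => cabs (g t)).
  have msqrt : measurable_fun [set: R] (@Num.sqrt R).
    apply: continuous_measurable_fun.
    exact: sqrt_continuous.
  rewrite (_ : (fun _ => _) = Num.sqrt \o
      (fun t => complex.Re (g t) ^+ 2 + complex.Im (g t) ^+ 2)).
    apply: measurableT_comp => //.
    by apply: measurable_funD; exact: measurable_funX.
  by apply/funext => t /=; case: (g t).
have absint (u : T -> R) : measurable_fun D u ->
    (forall t, `|u t| <= cabs (g t)) -> mu.-integrable D (EFin \o u).
  move=> mu' ule; apply/integrableP; split; first exact/measurable_EFinP.
  apply: le_lt_trans gfin; apply: ge0_le_integral => //.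
  - by apply: measurableT_comp => //; exact/measurable_EFinP.
  - exact/measurable_EFinP.
  - by move=> t _; rewrite /= lee_fin.
by split; apply: absint => // t; [exact: normr_Re_le_cabs|exact: normr_Im_le_cabs].
Qed.

Lemma cintegrable_restrict A g : measurable A -> cintegrable g ->
  cintegrable (fun t => g t * (\1_A t)%:C%C).
Proof.
move=> mA [gr gi].
have indint (u : T -> R) : mu.-integrable D (EFin \o u) ->
    mu.-integrable D (EFin \o (fun t => u t * \1_A t)).
  move=> iu; apply: le_integrable (iu) => //.
    apply/measurable_EFinP; apply: measurable_funM.
      by apply/measurable_EFinP; exact: measurable_int iu.
    exact: measurable_indic.
  move=> t _ /=; rewrite lee_fin normrM ler_piMr// indicE.
  by case: (_ \in _); rewrite ?normr1 ?normr0.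
split.
  apply: eq_integrable (indint _ gr) => // t _ /=.
  by case: (g t) => a b /=; rewrite mulr0 subr0.
apply: eq_integrable (indint _ gi) => // t _ /=.
by case: (g t) => a b /=; rewrite mulr0 add0r.
Qed.

End ComplexLinearity.

Section Balls.
Context {R : realType} {K : nonArchFieldType R}.
Implicit Types (s : seq K) (r : R) (t : K).

Definition vball (a : K) (r : R) : set K := [set t | vabs (t - a) <= r].

Lemma measurable_vball a r : 0 < r -> measurable (vball a r).
Proof.
move=> r0; apply: sub_sigma_algebra.
rewrite openE => t ta; rewrite /interior; apply/nbhs_ballP; exists r => //= s.
rewrite ballEmdist/= /vball/= => st.
apply: (vabsB_trans _ ta); rewrite vabsB_sym; exact: ltW.
Qed.

Lemma ring_of_integersE : ring_of_integers K = vball 0 1.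
Proof. by apply/seteqP; split=> t; rewrite /vball /= subr0. Qed.

Lemma measurable_ring_of_integers : measurable (ring_of_integers K).
Proof. by rewrite ring_of_integersE; exact: measurable_vball. Qed.

Definition integer_ball (a : K) (r : R) : set K :=
  [set t | ring_of_integers K t /\ vabs (t - a) <= r].

Lemma measurable_integer_ball a r : 0 < r -> measurable (integer_ball a r).
Proof.
move=> r0; apply: measurableI; first exact: measurable_ring_of_integers.
exact: measurable_vball.
Qed.

Lemma mu_vball1 (mu : {sigma_finite_measure set K -> \bar R}) a :
  normalised_haar mu -> mu (vball a 1) = 1%E.
Proof.
move=> haar; rewrite -(haar_normalised haar).
rewrite -(haar_translation haar a measurable_ring_of_integers); congr (mu _).
apply/seteqP; split=> [t ta|_ [y y1 <-]]; last by rewrite /vball /= addrC addKr.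
by exists (t - a) => //; rewrite addrC subrK.
Qed.

Lemma net_vball_inj s r (v w : seq_sub s) t : separated_net s r ->
  vabs (t - val v) <= r -> vabs (t - val w) <= r -> v = w.
Proof.
move=> [_ _ ssep] tv tw; apply: val_inj; apply: ssep; rewrite ?ssvalP//.
by apply: vabsB_trans tw; rewrite vabsB_sym.
Qed.

Lemma net_point_near s r t : separated_net s r -> vabs t <= 1 ->
  exists v : seq_sub s, vabs (t - val v) <= r.
Proof. by move=> [_ scov _] /scov[a as_ ta]; exists (SeqSub as_). Qed.

Lemma separated_net_fsum (Z : nmodType) s r (F : set K -> Z) :
  separated_net s r ->
  \sum_(I \in integer_balls r) F I =
  \sum_(w : seq_sub s) F (integer_ball (val w) r).
Proof.
move=> snet; have [s1 scov _] := snet.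
have r0 : 0 <= r.
  have [|a _ ra] := scov 0; first by rewrite vabs0 ler01.
  exact: le_trans (vabs_ge0 _) ra.
have -> : integer_balls r =
    [set integer_ball (val w) r | w in [set: seq_sub s]] :> set (set K).
  apply/seteqP; split=> [_ [x x1 <-]|_ [w _ <-]]; last first.
    by exists (val w) => //; rewrite /ring_of_integers/= s1 ?ssvalP.
  have [w xw] := net_point_near snet x1; exists w => //.
  apply/seteqP; split=> t [t1 tx]; split=> //; last exact: vabsB_trans xw.
  by apply: vabsB_trans tx _; rewrite vabsB_sym.
rewrite fsbig_image; last first.
  move=> v w _ _ vw; have : integer_ball (val v) r (val v).
    split; first by rewrite /ring_of_integers/= s1 ?ssvalP.
    by rewrite subrr vabs0.
  rewrite vw => -[_ vw']; have [_ _ ssep] := snet.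
  by apply: val_inj; apply: ssep; rewrite ?ssvalP.
rewrite [RHS]fsbig_seq ?index_enum_uniq//; apply: eq_fsbigl.
by apply/seteqP; split=> w //= _; exact: mem_index_enum.
Qed.

End Balls.

(** * Extension operator and norms as finite sums *)

Section FiniteSums.
Context {R : realType} {K : nonArchFieldType R} (pi : K) (e : K -> R[i])
  (mu : {sigma_finite_measure set K -> \bar R}).
Context (e_char : standard_character pi e) (mu_haar : normalised_haar mu).
Context {n : nat}.
Implicit Types (y : n.-tuple K) (f : K -> R[i]).

Lemma phase_close_freq y t b r : vabs t <= 1 -> vabs b <= 1 ->
  vabs (t - b) <= r -> (forall i, vabs (tnth y i) * r <= 1) ->
  vabs (phase y t - phase y b) <= 1.
Proof.
move=> t1 b1 tb yr; rewrite /phase -sumrB; apply: vabs_sum_le => // i _.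
rewrite -mulrBr vabsM (le_trans _ (yr i))// ler_wpM2l ?vabs_ge0//.
exact: vabs_subrXX.
Qed.

Lemma phase_close_point y y' t : vabs t <= 1 ->
  (forall i, vabs (tnth y i - tnth y' i) <= 1) ->
  vabs (phase y t - phase y' t) <= 1.
Proof.
move=> t1 yy'; rewrite /phase -sumrB; apply: vabs_sum_le => // i _.
by rewrite -mulrBl mulrC vabsM_le1// vabs_expr_le1.
Qed.

Definition ball_mass f (a : K) (r : R) : R[i] :=
  cintegral mu (ring_of_integers K) (restrict_to (integer_ball a r) f).

(** At points [y] of size at most [r^-1] the character is constant on balls of
    radius [r], so only the integrals of [f] over these balls matter. The
    predicate [P] selects the balls on which [h] agrees with [f]; elsewhere [h]
    vanishes. This covers [f] itself and its restrictions to larger balls. *)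
Lemma extension_net_sum s r y f h (P : pred (seq_sub s)) : 0 < r ->
  separated_net s r -> L1 mu (ring_of_integers K) f ->
  (forall i, vabs (tnth y i) * r <= 1) ->
  (forall t (v : seq_sub s), vabs t <= 1 -> vabs (t - val v) <= r ->
     h t = f t *+ P v) ->
  extension mu e h y =
  \sum_(v : seq_sub s | P v) ball_mass f (val v) r * e (phase y (val v)).
Proof.
move=> r0 snet fL1 yr hE; have [s1 _ _] := snet.
have mo := @measurable_ring_of_integers R K.
transitivity (cintegral mu (ring_of_integers K) (fun t =>
    \sum_(v : seq_sub s | P v)
      e (phase y (val v)) * restrict_to (integer_ball (val v) r) f t)).
  apply: eq_cintegral => t; rewrite inE => t1.
  have [v0 tv0] := net_point_near snet t1.
  rewrite (hE _ v0)// -/(phase y t).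
  have indC (A : set K) : (\1_A t)%:C%C = \1_A t :> R[i].
    by rewrite !indicE rmorph_nat.
  under eq_bigr do rewrite /restrict_to mulrA indC.
  rewrite (@big_indic _ _ _ P (fun v : seq_sub s => integer_ball (val v) r)
      (fun v => e (phase y (val v)) * f t) t v0)//.
    rewrite mulrnAr; congr (_ * _ *+ _); apply: (char_eq_close e_char).
    by apply: (phase_close_freq _ _ tv0) => //; rewrite s1 ?ssvalP.
  by move=> v w [_ tv] [_ tw]; exact: net_vball_inj tv tw.
rewrite cintegral_sum//; first by apply: eq_bigr => v _; rewrite mulrC.
move=> v; apply: cintegrable_restrict => //; first exact: measurable_integer_ball.
exact: L1_cintegrable.
Qed.

Lemma Kn_ballP (x y : n.-tuple K) r : 0 <= r ->
  Kn_ball x r y <-> forall i, vabs (tnth y i - tnth x i) <= r.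
Proof.
move=> r0; rewrite /Kn_ball /Kn_norm /=; split=> [/bigmax_leP[_ h] i|h].
  by have := h i isT; rewrite tnth_mktuple.
by apply/bigmax_leP; split=> // i _; rewrite tnth_mktuple.
Qed.

Definition unit_box (z : n.-tuple K) : set (n.-tuple K) :=
  [set y | forall i, vball (tnth z i) 1 (tnth y i)].

Lemma measurable_unit_box z : measurable (unit_box z).
Proof.
rewrite (_ : unit_box z =
    \bigcap_(i : 'I_n) ((@tnth n K)^~ i @^-1` vball (tnth z i) 1)).
  apply: fin_bigcap_measurable => // i _.
  rewrite -[X in measurable X]setTI; apply: measurable_tnth => //.
  exact: measurable_vball.
by apply/seteqP; split => [t h i _|t h i]; exact: h.
Qed.

Lemma prod_measure_unit_box z : prod_measure mu n (unit_box z) = 1%E.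
Proof.
rewrite (@prod_measureE _ _ _ mu n (fun i => vball (tnth z i) 1)); last first.
  by move=> i; exact: measurable_vball.
by rewrite big1// => i _; exact: mu_vball1.
Qed.

Section Box.
Context (s : seq K) (N : nat) (pi0 : pi != 0)
  (snet : separated_net s (vabs pi ^+ N)).
Implicit Types (o : {ffun 'I_n -> seq_sub s}).

Let piN0 : 0 < vabs pi ^+ N.
Proof.
rewrite exprn_gt0// lt_neqAle eq_sym vabs_ge0 andbT.
by apply: contra_neq pi0 => /vabs_eq0.
Qed.

Let vabs_scale (a b : K) c :
  (vabs (pi ^+ N * a - b) <= vabs pi ^+ N * c) = (vabs (a - pi ^- N * b) <= c).
Proof.
rewrite -[X in _ - X](mulVKf (expf_neq0 N pi0)) -mulrBr vabsM vabsX.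
by rewrite ler_pM2l.
Qed.

Lemma net_point_box_inj x o o' y :
  unit_box (net_point pi N x o) y -> unit_box (net_point pi N x o') y -> o = o'.
Proof.
have near (w : {ffun 'I_n -> seq_sub s}) i : unit_box (net_point pi N x w) y ->
    vabs (pi ^+ N * (tnth y i - tnth x i) - val (w i)) <= vabs pi ^+ N.
  move=> /(_ i); rewrite /vball /= tnth_mktuple opprD addrA => h.
  by rewrite -[leRHS]mulr1 vabs_scale.
move=> oy o'y; apply/ffunP => i.
exact: net_vball_inj snet (near _ _ oy) (near _ _ o'y).
Qed.

Lemma Kn_ball_net_cover x y : vabs pi <= 1 -> Kn_ball x ((vabs pi)^-1 ^+ N) y <->
  exists o, unit_box (net_point pi N x o) y.
Proof.
move=> pi1; have [s1 _ _] := snet.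
have q1 : 1 <= (vabs pi ^+ N)^-1 by rewrite invf_ge1// exprn_ile1// vabs_ge0.
rewrite exprVn; split=> [yB|[w wy]].
  have xy := (Kn_ballP _ _ (le_trans ler01 q1)).1 yB.
  have /choice[w wP] : forall i, exists v : seq_sub s,
      vabs (pi ^+ N * (tnth y i - tnth x i) - val v) <= vabs pi ^+ N.
    move=> i; apply: net_point_near snet _.
    by rewrite vabsM vabsX -ler_pdivlMl// mulr1.
  exists [ffun i => w i] => i; rewrite /vball /= tnth_mktuple ffunE opprD addrA.
  by rewrite -vabs_scale mulr1.
apply/Kn_ballP; first exact: le_trans ler01 q1.
move=> i; have := wy i; rewrite /vball /= tnth_mktuple opprD addrA => h.
rewrite -(subrK (pi ^- N * val (w i)) (_ - _)) vabsD_le//; first exact: le_trans q1.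
by rewrite vabsM vabsV vabsX ler_piMr ?invr_ge0 ?(ltW piN0)// s1 ?ssvalP.
Qed.

(** The ball is the disjoint union of finitely many unit boxes of measure [1],
    so the norm of a function constant on them is a finite sum. *)
Lemma Lp_norm_on_box m x (g : n.-tuple K -> R) : (0 < m)%N -> vabs pi <= 1 ->
  (forall y, 0 <= g y) ->
  (forall o y, unit_box (net_point pi N x o) y -> g y = g (net_point pi N x o)) ->
  Lp_norm_on mu m%:R (Kn_ball x ((vabs pi)^-1 ^+ N)) g =
  ((\sum_(o : {ffun 'I_n -> seq_sub s}) g (net_point pi N x o) ^+ m) `^ m%:R^-1)%:E.
Proof.
move=> m0 pi1 g0 gconst; rewrite /Lp_norm_on unlock.
suff -> : (\int[prod_measure mu n]_y
    `|((EFin \o g) \_ (Kn_ball x ((vabs pi)^-1 ^+ N))) y| `^ m%:R =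
    (\sum_(o : {ffun 'I_n -> seq_sub s}) g (net_point pi N x o) ^+ m)%:E)%E by rewrite poweR_EFin.
have mR : (m%:R : R) != 0 by rewrite pnatr_eq0 -lt0n.
transitivity (\int[prod_measure mu n]_y
    (\sum_(o : {ffun 'I_n -> seq_sub s}) ((g (net_point pi N x o) ^+ m)%:E *
      (\1_(unit_box (net_point pi N x o)) y)%:E))%E)%E.
  apply: eq_integral => y _.
  under eq_bigr do rewrite -EFinM.
  rewrite sumEFin patchE; case: ifPn => [|].
    rewrite inE => /(Kn_ball_net_cover _ _ pi1) [w wy].
    rewrite (@big_indic _ _ _ predT
      (fun o : {ffun 'I_n -> seq_sub s} => unit_box (net_point pi N x o))
      (fun o : {ffun 'I_n -> seq_sub s} => g (net_point pi N x o) ^+ m) y w)//; last first.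
      by move=> u v; exact: net_point_box_inj.
    rewrite /= mulr1n (gconst _ _ wy) ger0_norm//.
    by rewrite powR_mulrn.
  move=> /negP yB; rewrite abse0 poweR0r// big1// => o _.
  rewrite indicE memNset ?mulr0// => oy; apply: yB; rewrite inE.
  by apply/Kn_ball_net_cover => //; exists o.
rewrite ge0_integral_sum//; last 2 first.
- move=> o; apply: measurable_funeM; apply/measurable_EFinP.
  by apply: measurable_indic; exact: measurable_unit_box.
- by move=> o y _; rewrite mule_ge0 ?lee_fin ?exprn_ge0// indicE ler0n.
rewrite -sumEFin; apply: eq_bigr => o _.
rewrite ge0_integralZl//; last first.
- by rewrite lee_fin exprn_ge0.
- apply/measurable_EFinP; apply: measurable_indic; exact: measurable_unit_box.
rewrite integral_indic ?setIT//; last exact: measurable_unit_box.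
rewrite -[RHS]mule1; congr (_ * _)%E; exact: prod_measure_unit_box.
Qed.

End Box.
End FiniteSums.

Lemma exists_exponent_le {R : realType} (c r : R) : 0 < r < 1 ->
  exists N, forall M, (N <= M)%N -> c * r ^+ M <= 1.
Proof.
move=> /andP[r0 r1].
have [c0|c0] := leP c 0.
  exists 0%N => M _; apply: le_trans ler01.
  by rewrite mulr_le0_ge0// exprn_ge0// ltW.
have /cvgrPdist_le/(_ c^-1) : (GRing.exp r : R ^nat) @ \oo --> (0 : R).
  by apply: cvg_expr; rewrite gtr0_norm.
rewrite invr_gt0 => /(_ c0)[N _ NP]; exists N => M /NP /=.
rewrite sub0r normrN ger0_norm ?exprn_ge0 ?(ltW r0)// => rMc.
by rewrite mulrC -ler_pdivlMr// mul1r.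
Qed.

(** * The square function estimate *)

Theorem theorem1p1 (R : realType) (K : nonArchFieldType R)
    (K_local : local_field K)
    (pi : K) (pi_unif : is_uniformiser pi)
    (mu : {sigma_finite_measure set K -> \bar R}) (mu_haar : normalised_haar mu)
    (e : K -> R[i]) (e_char : standard_character pi e)
    (n : nat) (n_ge2 : (2 <= n)%N)
    (char_gt_n : exists2 p : nat, p \in [pchar (residue_field K)] & (n < p)%N)
    (m : nat) (m_bounds : (1 <= m <= n)%N) (alpha : nat)
    (f : K -> R[i]) (f_L1 : L1 mu (ring_of_integers K) f) (x : n.-tuple K) :
  let q := (vabs pi)^-1 in
  let B := Kn_ball x (q ^+ (alpha * n)%N) in
  (Lp_norm_on mu (2 * m)%N%:R B (fun y => cabs (extension mu e f y)) <=
   ((m`!)%N%:R `^ (2 * m)%N%:R^-1)%:E *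
   Lp_norm_on mu (2 * m)%N%:R B (square_function mu e (q ^- alpha) f))%E.
Proof.
cbv zeta; set q := (vabs pi)^-1; set B := Kn_ball _ _.
pose N := (alpha * n)%N; have /andP[m0 mn] := m_bounds.
have pi0 := uniformiser_gt0 K_local pi_unif.
have pi1 := uniformiser_lt1 pi_unif.
have piX j : 0 < vabs pi ^+ j by exact: exprn_gt0.
have pin0 := uniformiser_neq0 K_local pi_unif.
(* The precision [M] is so fine that on every ball of radius [vabs pi ^+ M] all
   the characters occurring for points of [B] are constant, and that these
   balls refine those of the square function. *)
have [M0 M0P] := @exists_exponent_le R (Kn_norm x) (vabs pi) (introT andP (conj pi0 pi1)).
pose M := (M0 + (alpha + N))%N.
have piMle j : (j <= M)%N -> vabs pi ^+ M <= vabs pi ^+ j.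
  by move=> jM; rewrite ler_wiXn2l ?ltW.
have [sa saP] := exists_separated_net K_local pi_unif alpha.
have [sN sNP] := exists_separated_net K_local pi_unif N.
have [sM sMP] := exists_separated_net K_local pi_unif M.
have sM1 : {in sM, forall t, vabs t <= 1} by case: sMP.
have /choice[par parP] : forall v : seq_sub sM, exists w : seq_sub sa,
    vabs (val v - val w) <= vabs pi ^+ alpha.
  by move=> v; apply: net_point_near saP _; rewrite sM1 ?ssvalP.
pose kappa (v : seq_sub sM) := ball_mass mu f (val v) (vabs pi ^+ M).
pose block (y : n.-tuple K) (w : seq_sub sa) :=
  \sum_(v | par v == w) kappa v * e (phase y (val v)).
have yM y : B y -> forall i, vabs (tnth y i) * vabs pi ^+ M <= 1.
  move=> By i; rewrite -ler_pdivlMr// mul1r.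
  have yx : vabs (tnth y i - tnth x i) <= q ^+ N.
    have qN0 : 0 <= q ^+ N by rewrite exprn_ge0// invr_ge0 ltW.
    exact: (Kn_ballP _ _ qN0).1 By i.
  rewrite -(subrK (tnth x i) (tnth y i)) vabsD_le//.
    rewrite (le_trans yx)// /q exprVn lef_pV2 ?posrE// piMle//.
    by rewrite /M addnA leq_addl.
  rewrite -[leRHS]mul1r ler_pdivlMr// (le_trans _ (M0P M (leq_addr _ _)))//.
  by rewrite ler_pM2r// /Kn_norm le_bigmax.
have EfE y : B y ->
    extension mu e f y = \sum_v kappa v * e (phase y (val v)).
  by move=> /yM yM'; apply: (extension_net_sum e_char _ sMP f_L1 yM').
have EwE y w : B y ->
    extension mu e (restrict_to (integer_ball (val w) (vabs pi ^+ alpha)) f) y =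
    block y w.
  move=> /yM yM'; apply: (extension_net_sum e_char _ sMP f_L1 yM') => // t v t1 tv.
  have tpar : vabs (t - val (par v)) <= vabs pi ^+ alpha.
    apply: vabsB_trans (parP v); apply: le_trans tv _; apply: piMle.
    by rewrite /M addnCA leq_addr.
  rewrite /restrict_to indicE; have [parw|parw] := eqVneq (par v) w.
    by rewrite mem_set ?mulr1//; split; rewrite -?parw.
  rewrite memNset ?mulr0// => -[_ tw]; move/eqP: parw; apply.
  exact: net_vball_inj saP tpar tw.
have SfE y : B y -> square_function mu e (q ^- alpha) f y =
    Num.sqrt (\sum_w cabs (block y w) ^+ 2).
  move=> By; rewrite /square_function; congr Num.sqrt.
  have -> : q ^- alpha = vabs pi ^+ alpha by rewrite /q exprVn invrK.
  rewrite (separated_net_fsum _ saP); apply: eq_bigr => w _.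
  by rewrite EwE.
have boxB (w : {ffun 'I_n -> seq_sub sN}) y : unit_box (net_point pi N x w) y -> B y.
  by move=> wy; apply/(Kn_ball_net_cover pin0 sNP) => //; [exact: ltW|exists w].
have ptB (w : {ffun 'I_n -> seq_sub sN}) : B (net_point pi N x w).
  by apply: (boxB w) => i; rewrite /vball/= subrr vabs0.
have phaseE (w : {ffun 'I_n -> seq_sub sN}) y t : unit_box (net_point pi N x w) y -> vabs t <= 1 ->
    e (phase y t) = e (phase (net_point pi N x w) t).
  by move=> wy t1; apply: (char_eq_close e_char); exact: phase_close_point.
have m20 : (0 < 2 * m)%N by rewrite muln_gt0.
pose pt (w : {ffun 'I_n -> seq_sub sN}) := net_point pi N x w.
rewrite (@Lp_norm_on_box _ _ pi mu mu_haar n sN N pin0 sNP (2 * m) x)//; last 3 first.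
- exact: ltW.
- by move=> y; rewrite /cabs; case: (extension _ _ _ _) => a b; exact: sqrtr_ge0.
- move=> w y wy; rewrite !EfE//; last exact: boxB wy.
  congr cabs; apply: eq_bigr => v _.
  by rewrite (phaseE _ _ _ wy)// sM1 ?ssvalP.
rewrite (@Lp_norm_on_box _ _ pi mu mu_haar n sN N pin0 sNP (2 * m) x
  (square_function mu e (q ^- alpha) f))//; last 3 first.
- exact: ltW.
- by move=> y; exact: sqrtr_ge0.
- move=> w y wy; rewrite !SfE//; last exact: boxB wy.
  congr Num.sqrt; apply: eq_bigr => u _; congr (cabs _ ^+ 2).
  apply: eq_bigr => v _.
  by rewrite (phaseE _ _ _ wy)// sM1 ?ssvalP.
rewrite -EFinM lee_fin -powRM//; last first.
  by apply: sumr_ge0 => w _; rewrite exprn_ge0// sqrtr_ge0.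
have cabs_ge0 z : 0 <= cabs z :> R by case: z => a b; exact: sqrtr_ge0.
have key : \sum_w cabs (extension mu e f (pt w)) ^+ (2 * m) <=
    m`!%:R * \sum_w square_function mu e (q ^- alpha) f (pt w) ^+ (2 * m).
  have S0 w : 0 <= \sum_u cabs (block (pt w) u) ^+ 2.
    by apply: sumr_ge0 => u _; exact: exprn_ge0.
  under eq_bigr do rewrite EfE//.
  under [in leRHS]eq_bigr do rewrite SfE// exprM sqr_sqrtr//.
  rewrite -lecR rmorphM rmorph_nat !rmorph_sum/=.
  have := discrete_decoupling K_local pi_unif e_char x kappa
    (vabs_natr_eq1 char_gt_n) mn saP sNP sM1 parP.
  congr (_ <= _ * _); apply: eq_bigr => w _.
    by rewrite normc_cabs -rmorphXn.
  rewrite rmorphXn rmorph_sum/=; congr (_ ^+ m); apply: eq_bigr => u _.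
  by rewrite normc_cabs -rmorphXn.
by apply: ge0_ler_powR => //; rewrite ?nnegrE ?mulr_ge0 ?sumr_ge0// ?invr_ge0// => w _;
  rewrite exprn_ge0// sqrtr_ge0.
Qed.
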